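(* Let $(\mathcal M,d)$ be a complete NPC space, $\mathcal Z$ an arbitrary measurable space, $\ell:\mathcal M\times\mathcal Z\to\mathbb R$ a fixed function and $\Theta\subset\mathcal M$. Let $m_1\in\mathcal M$ and, for each $t\ge2$, let $m_t:\mathcal Z^{t-1}\to\mathcal M$ be a function. Suppose that for every $T\ge1$ there exists $B_T>0$ such that, for all $(z_1,\dots,z_T)\in\mathcal Z^T$, $$\sum_{t=1}^T\ell(\hat m_t,z_t)-\inf_{\theta\in\Theta}\sum_{t=1}^T\ell(\theta,z_t)\le B_T,$$ where $\hat m_1=m_1$ and $\hat m_t=m_t(z_1,\dots,z_{t-1})$ for $t\ge2$. Suppose also that, for all $z\in\mathcal Z$, the function $\ell(\cdot,z):\mathcal M\to\mathbb R$ is geodesically convex. Let $Z,Z_1,Z_2,\dots$ be independent and identically distributed $\mathcal Z$-valued random variables and, for $n\ge1$, let $$\theta_n\in\underset{m\in\mathcal M}{\arg\min}\left\{d^2(m,m_1)+\sum_{i=2}^{n+1}d^2\big(m,m_i(Z_1,\dots,Z_{i-1})\big)\right\}.$$ Then, for all $n\ge1$, $$\mathbb E[\ell(\theta_n,Z)]-\inf_{\theta\in\Theta}\mathbb E[\ell(\theta,Z)]\le\frac{B_{n+1}}{n+1}.$$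
   Context: A geodesic in a metric space $(M,d)$ is a continuous map $\gamma:[0,1]\to M$ with $d(\gamma(s),\gamma(t))=(t-s)d(\gamma(0),\gamma(1))$ for all $0\le s\le t\le 1$; $(M,d)$ is geodesic if any two points are joined by a geodesic. An NPC space is a geodesic space $(M,d)$ such that for every $p,x,y\in M$, every geodesic $\gamma$ from $x$ to $y$ and every $t\in[0,1]$, $d^2(p,\gamma(t))\le(1-t)d^2(p,x)+t\,d^2(p,y)-t(1-t)d^2(x,y)$. A function $f:M\to\mathbb R$ is geodesically convex if $f\circ\gamma$ is convex on $[0,1]$ for every geodesic $\gamma:[0,1]\to M$. A barycenter of a Borel probability measure $P$ on $M$ with $\int_M d^2(x,y)\,\mathrm dP(y)<\infty$ for all $x\in M$ is any minimizer over $x\in M$ of $\int_M d^2(x,y)\,\mathrm dP(y)$; in a complete NPC space it exists and is unique. Thus $\theta_n$ is the unique barycenter of the random probability measure $\frac1{n+1}\delta_{m_1}+\frac1{n+1}\sum_{i=2}^{n+1}\delta_{m_i(Z_1,\dots,Z_{i-1})}$, where $\delta_m$ is the Dirac mass at $m$; it depends only on $Z_1,\dots,Z_n$.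
   Formalization: Each ℓ(·,z) is also assumed lower semicontinuous, without which Jensen's inequality at barycenters, and the claim, can fail; the losses averaged are assumed measurable, and E[ℓ(θ,Z)] for θ in Θ is assumed to be well defined in [−∞,+∞]. *)

(* Defs.v *)
From HB Require Import structures.
From mathcomp Require Import all_boot all_order all_algebra finmap.
From mathcomp Require Import all_classical all_reals all_analysis.
Import Order.TTheory GRing.Theory Num.Theory.
Import numFieldNormedType.Exports.

Set Implicit Arguments.
Unset Strict Implicit.
Unset Printing Implicit Defensive.

Local Open Scope classical_set_scope.
Local Open Scope ring_scope.

Section NPC.
Context {R : realType} {M : metricType R}.
Implicit Types (g : R -> M) (f : M -> R).

(* A path [0, 1] -> M is represented by a map on R; only its restriction to
   [0, 1] is ever used. *)
Definition geodesic g :=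
  {within `[0, 1], continuous g} /\
  forall s t : R, 0 <= s -> s <= t -> t <= 1 ->
    mdist (g s) (g t) = (t - s) * mdist (g 0) (g 1).

Definition geodesic_from_to g (x y : M) := [/\ geodesic g, g 0 = x & g 1 = y].

Definition geodesic_space := forall x y : M, exists g, geodesic_from_to g x y.

Definition NPC_space :=
  geodesic_space /\
  forall (p x y : M) g, geodesic_from_to g x y ->
  forall t : R, 0 <= t -> t <= 1 ->
    mdist p (g t) ^+ 2 <=
      (1 - t) * mdist p x ^+ 2 + t * mdist p y ^+ 2
      - t * (1 - t) * mdist x y ^+ 2.

(* The library's [completeType] is pointed and not joined with [metricType],
   hence completeness as a predicate. *)
Definition complete_metric :=
  forall u : nat -> M, cauchy (u @ \oo) -> exists l : M, u @ \oo --> l.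

Definition geodesically_convex f :=
  forall g, geodesic g ->
    convex_function (`[0, 1] : set R^o) (f \o g : R^o -> R^o).

Definition argmin f : set M := [set x | forall y, f x <= f y].

End NPC.
Arguments NPC_space {R} M.
Arguments complete_metric {R} M.

Section Probability.
Context {R : realType} {d d' : measure_display}.
Context {Omega : measurableType d} {E : measurableType d'}.
Variable P : probability Omega R.

Definition mutually_independent (I : choiceType) (X : I -> Omega -> E) :=
  forall (J : {fset I}) (A : I -> set E),
    (forall i, i \in J -> measurable (A i)) ->
    P (\bigcap_(i in [set` J]) X i @^-1` A i) =
    (\prod_(i <- J) P (X i @^-1` A i))%E.

Definition identically_distributed (I : Type) (X : I -> Omega -> E) :=
  forall (i j : I) (A : set E), measurable A ->
    P (X i @^-1` A) = P (X j @^-1` A).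

Definition iid (I : choiceType) (X : I -> Omega -> E) :=
  [/\ forall i, measurable_fun setT (X i),
      mutually_independent X & identically_distributed X].

(* The expectation of X makes sense in [-oo, +oo], i.e. E[X] is not of the form
   oo - oo. *)
Definition expectation_exists (X : Omega -> R) :=
  ('E_P[X^\+] < +oo)%E \/ ('E_P[X^\-] < +oo)%E.

End Probability.

(* (z_1, ..., z_t), where z_i is [z i.-1]: sequences are indexed from 0. *)
Definition first_terms {E : Type} (z : nat -> E) (t : nat) : t.-tuple E :=
  [tuple z i | i < t].

Section Regret.
Context {R : realType} {M E : Type}.
Variables (loss : M -> E -> R) (m : forall t : nat, t.-tuple E -> M).

(* [m t] is m_{t+1} : E^t -> M, so that the constant m_1 is [m 0] on the only
   0-tuple. [prediction z t] is the prediction made after seeing the first t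
   terms of z, to be compared with the next term [z t] = z_{t+1}. *)
Definition prediction (z : nat -> E) (t : nat) : M := m (first_terms z t).

Definition regret (Theta : set M) (T : nat) (z : nat -> E) : \bar R :=
  ((\sum_(t < T) loss (prediction z t) (z t))%:E
   - ereal_inf [set (\sum_(t < T) loss theta (z t))%:E | theta in Theta])%E.

End Regret.

(* Main.v *)
Require Import Defs.
From HB Require Import structures.
From mathcomp Require Import all_boot all_order all_algebra finmap.
From mathcomp Require Import all_classical all_reals all_analysis.
From mathcomp Require Import measurable_realfun ring lra.
Import Order.TTheory GRing.Theory Num.Theory.
Import numFieldNormedType.Exports.

(** The loss is convex along geodesics and [theta_n] is the barycenter of the
    predictions made on [Z_1, ..., Z_n], so Jensen's inequality bounds
    [loss theta_n Z] by the average of the [loss m_i Z] ([NPC_Jensen]). Each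
    prediction [m_i] depends on [Z_1, ..., Z_(i-1)] only, hence is independent
    of [Z] and of [Z_i] alike, and [loss m_i Z] has the law of [loss m_i Z_i].
    The sum of the latter is the cumulative loss of the online strategy, which
    the regret bound compares with the cumulative loss of any competitor; taking
    expectations and dividing by [n + 1] gives the result ([online_to_batch]).

    Two points need more than this sketch.

    Jensen's inequality, for a function that is only lower semicontinuous, says
    that the barycenter of the points [(x_i, f x_i)] of the epigraph of [f]
    stays in the epigraph. The barycenter is approached from inside the epigraph
    by moving, at time [k], a fraction [1 / (k + 1)] of the way towards a well
    chosen [(x_i, f x_i)]. On average over [i] the squared distance to the
    barycenter contracts as in the law of large numbers, because of the NPC
    inequality and of the variance inequality, so some [i] does at least as well.

    Nothing makes the [loss m_i Z_i] integrable, so that their sum cannot be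
    integrated term by term. Only the positive part of the loss of a competitor
    is under control. If the negative part of [loss theta_n Z] is not
    integrable, its expectation is [-oo] and there is nothing to prove.
    Otherwise, the negative part of the sum of the [loss m_i Z] is integrable,
    and freezing the past in the regret bound controls their positive parts;
    hence, given almost every past, each prediction has a finite mean loss: its
    risk ([batch_integrable_loss]). The differences between the [loss m_i Z_i]
    and the risks are the increments of a generalized martingale, whose final
    value has an integrable positive part. Such a process is a true martingale
    ([compensated_martingale]), so that the sum of the risks and the
    sum of the [loss m_i Z_i] have the same expectation ([batch_loss_le]). *)

Set Implicit Arguments.
Unset Strict Implicit.
Unset Printing Implicit Defensive.

Local Open Scope classical_set_scope.
Local Open Scope ring_scope.

(** * Jensen's inequality for barycenters in NPC spaces *)

Lemma exists_le_average (R : realType) (I : finType) (F : I -> R) (c : R) :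
  (0 < #|I|)%N -> \sum_i F i <= #|I|%:R * c -> exists i, F i <= c.
Proof.
move=> I0 Fc; apply/not_existsP => Fgt.
have /card_gt0P[i0 _] := I0.
suff : #|I|%:R * c < \sum_i F i by rewrite ltNge Fc.
rewrite mulr_natl -sumr_const; apply: ltr_sum => [|i _].
  by apply/hasP; exists i0 => //; rewrite mem_index_enum.
by rewrite ltNge; apply/negP/Fgt.
Qed.

Section NPC_Jensen.
Context {R : realType} {M : metricType R} {I : finType}.
Variables (x : I -> M) (b : M).
Hypothesis NPC_M : NPC_space M.
Hypothesis b_min : argmin (fun y : M => \sum_i mdist y (x i) ^+ 2) b.

(** Moving from [b] towards [s] cannot decrease the sum of squared distances;
    the NPC inequality bounds this sum along the geodesic by a quadratic
    polynomial in the time, whose derivative at [0] is thus nonnegative. *)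
Lemma variance_inequality (s : M) :
  \sum_i mdist b (x i) ^+ 2 + #|I|%:R * mdist s b ^+ 2 <=
  \sum_i mdist s (x i) ^+ 2.
Proof.
have [ex_geo npc] := NPC_M.
have [g g_bs] := ex_geo b s.
set G := \sum_i mdist b (x i) ^+ 2; set Gs := \sum_i mdist s (x i) ^+ 2.
set c := #|I|%:R * mdist s b ^+ 2.
have Gle (t : R) : 0 <= t -> t <= 1 ->
    G <= (1 - t) * G + t * Gs - t * (1 - t) * c.
  move=> t0 t1; apply: (le_trans (b_min (g t))).
  rewrite /c mulr_natl -sumr_const !mulr_sumr -big_split/= -sumrB.
  apply: ler_sum => i _.
  by rewrite ![mdist _ (x i)]metric_sym (metric_sym s); exact: npc.
have Gle' (t : R) : 0 < t -> t <= 1 -> G + (1 - t) * c <= Gs.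
  move=> t0 t1; have := Gle t (ltW t0) t1.
  by rewrite -(ler_pM2l t0 (_ + _)); lra.
have c0 : 0 <= c by rewrite mulr_ge0 ?ler0n ?sqr_ge0.
apply/ler_addgt0Pl => e e0.
have c1 : 0 < c + e by lra.
(* A time so small that [t * c <= e]. *)
have := Gle' (e / (c + e)).
rewrite divr_gt0 // ler_pdivrMr // mul1r => /(_ isT) Gle_t.
have {Gle_t} : G + (1 - e / (c + e)) * c <= Gs by apply: Gle_t; lra.
have : e / (c + e) * c <= e by rewrite mulrAC ler_pdivrMr //; nra.
lra.
Qed.

Variable f : M -> R.
Hypothesis f_cvx : geodesically_convex f.

Lemma geodesically_convex_le g (t : R) : geodesic g -> 0 <= t -> t <= 1 ->
  f (g t) <= (1 - t) * f (g 0) + t * f (g 1).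
Proof.
move=> geo t0 t1.
pose t' : {i01 R} := Itv01 t0 t1.
have /(_ t' 1 0) := f_cvx geo; rewrite !inE/= !in_itv/= !lexx ler01.
move=> /(_ isT isT); rewrite /conv/=.
by rewrite scaler0 addr0 -[t *: (1 : R^o)]/(t * 1) mulr1 addrC.
Qed.

Let N : R := #|I|%:R.
Let a_bar : R := (\sum_i f (x i)) / N.
Let D (p : M * R) : R := mdist p.1 b ^+ 2 + (p.2 - a_bar) ^+ 2.
Let V : R := (\sum_i D (x i, f (x i))) / N.
Let epigraph (p : M * R) : Prop := f p.1 <= p.2.

Hypothesis I0 : (0 < #|I|)%N.

Let N0 : 0 < N. Proof. by rewrite ltr0n. Qed.

Let sum_centered : \sum_i (f (x i) - a_bar) = 0.
Proof.
rewrite sumrB sumr_const -mulr_natl -/N /a_bar mulrC divfK ?subrr//.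
by rewrite gt_eqF.
Qed.

(** Here [t] is the fraction of the geodesic travelled from [p] towards one of
    the points [(x i, f (x i))] in the product of [M] and the real line. The
    NPC inequality bounds the average over [i] of the resulting values of [D] by
    [(1 - t) * D p + t * V - t * (1 - t) * F], where [F], the mean squared
    distance from [p] to the points, is at least [V + D p] by the variance
    inequality: this gives the right-hand side below. *)
Lemma epigraph_step (p : M * R) (t : R) : epigraph p -> 0 <= t -> t <= 1 ->
  exists2 q, epigraph q & D q <= (1 - t) ^+ 2 * D p + t ^+ 2 * V.
Proof.
case: p => s a; rewrite /epigraph/= => fsa t0 t1.
have [ex_geo npc] := NPC_M.
have /choice[g g_sx] : forall i, exists g, geodesic_from_to g s (x i).
  by move=> i; exact: ex_geo.
pose q i : M * R := (g i t, (1 - t) * a + t * f (x i)).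
have q_epi i : epigraph (q i).
  have [geo g0 g1] := g_sx i.
  apply: (le_trans (geodesically_convex_le geo t0 t1)).
  by rewrite g0 g1/= lerD2r ler_wpM2l // subr_ge0.
suff [i Dqi] : exists i, D (q i) <= (1 - t) ^+ 2 * D (s, a) + t ^+ 2 * V.
  by exists (q i); [exact: q_epi|].
apply: exists_le_average => //.
(* The two factors are handled apart: an inequality in [M], an identity in
   the real line. *)
have metric_part : \sum_i mdist (g i t) b ^+ 2 <=
    (1 - t) ^+ 2 * (N * mdist s b ^+ 2) +
    t ^+ 2 * \sum_i mdist b (x i) ^+ 2.
  have : \sum_i mdist (g i t) b ^+ 2 <= \sum_i ((1 - t) * mdist s b ^+ 2 +
      t * mdist b (x i) ^+ 2 - t * (1 - t) * mdist s (x i) ^+ 2).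
    apply: ler_sum => i _.
    by rewrite (metric_sym _ b) (metric_sym s b); exact: npc.
  rewrite sumrB big_split/= sumr_const -!mulr_sumr -[_ *+ #|I|]mulr_natl -/N.
  have := variance_inequality s; rewrite -/N.
  have : 0 <= t * (1 - t) by rewrite mulr_ge0 // subr_ge0.
  move: (\sum_i _) (\sum_i _) (\sum_i _) => A B C tt vi.
  have := ler_wpM2l tt vi; lra.
have real_part : \sum_i ((1 - t) * a + t * f (x i) - a_bar) ^+ 2 =
    (1 - t) ^+ 2 * (N * (a - a_bar) ^+ 2) +
    t ^+ 2 * \sum_i (f (x i) - a_bar) ^+ 2.
  transitivity (\sum_i ((1 - t) ^+ 2 * (a - a_bar) ^+ 2 +
      2 * (1 - t) * t * (a - a_bar) * (f (x i) - a_bar) +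
      t ^+ 2 * (f (x i) - a_bar) ^+ 2)).
    by apply: eq_bigr => i _; ring.
  rewrite !big_split/= sumr_const -!mulr_sumr sum_centered.
  rewrite -[_ *+ #|I|]mulr_natl -/N.
  by ring.
rewrite -/N [leRHS]mulrDr.
have -> : N * (t ^+ 2 * V) = t ^+ 2 * \sum_i D (x i, f (x i)).
  by rewrite mulrCA /V [N * _]mulrC divfK // gt_eqF.
rewrite /D/= !big_split/= real_part.
under [\sum_i mdist (x i) _ ^+ 2]eq_bigr do rewrite metric_sym.
by move: metric_part; lra.
Qed.

(** The value [1 / (m + 1)] of [t] minimizes
    [(1 - t) ^+ 2 * (V / m) + t ^+ 2 * V], with minimum [V / (m + 1)]: the rate
    of the law of large numbers. *)
Lemma epigraph_approximation k :
  exists2 q, epigraph q & D q <= V / k.+1%:R.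
Proof.
elim: k => [|k [p p_epi Dp]].
  rewrite divr1.
  have [i Di] : exists i, D (x i, f (x i)) <= V.
    by apply: exists_le_average => //; rewrite /V mulrC divfK // gt_eqF.
  by exists (x i, f (x i)) => //; rewrite /epigraph/=.
set m : R := k.+1%:R.
have m0 : 0 < m by rewrite ltr0n.
have E : k.+2%:R = m + 1 :> R by rewrite /m -natr1.
have m1 : 0 < m + 1 by lra.
have [||q q_epi Dq] := @epigraph_step p (m + 1)^-1 p_epi.
- by rewrite invr_ge0 ltW.
- by rewrite invf_le1 //; lra.
exists q => //; apply: (le_trans Dq).
have : (1 - (m + 1)^-1) ^+ 2 * D p <= (1 - (m + 1)^-1) ^+ 2 * (V / m).
  by rewrite ler_wpM2l // sqr_ge0.
have -> : V / k.+2%:R =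
    (1 - (m + 1)^-1) ^+ 2 * (V / m) + (m + 1)^-1 ^+ 2 * V.
  by rewrite E; field; rewrite !gt_eqF.
by rewrite lerD2r.
Qed.

(** The epigraph comes arbitrarily close to [(b, a_bar)], the barycenter of the
    points [(x i, f (x i))], and it is closed as [f] is lower semicontinuous. *)
Lemma NPC_Jensen : lower_semicontinuous (fun y : M => (f y)%:E) ->
  #|I|%:R * f b <= \sum_i f (x i).
Proof.
move=> f_lsc; rewrite mulrC -ler_pdivlMr // leNgt -/N -/a_bar; apply/negP => ab.
have [c /andP[ac cb]] : exists c, a_bar < c < f b.
  by exists ((a_bar + f b) / 2); rewrite !midf_lt.
have [U] := f_lsc b c cb.
rewrite -nbhs_ballE => -[e /= e0 eU] U_gt.
pose r := Num.min (e ^+ 2) ((c - a_bar) ^+ 2).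
have r0 : 0 < r by rewrite lt_min !exprn_gt0 // subr_gt0.
have V0 : 0 <= V.
  apply: divr_ge0; last exact: ltW.
  by apply: sumr_ge0 => i _; rewrite addr_ge0 // sqr_ge0.
pose k := Num.bound (V / r).
have Vk : V / k.+1%:R < r.
  rewrite ltr_pdivrMr // mulrC -ltr_pdivrMr //.
  apply: (lt_le_trans (archi_boundP _)); first by rewrite divr_ge0 // ltW.
  by rewrite ler_nat.
have [[s a] /= fsa Dsa] := epigraph_approximation k.
have {Dsa} := le_lt_trans Dsa Vk; rewrite /D/= lt_min => /andP[De Dc].
have sb : mdist b s < e.
  rewrite metric_sym -(@ltr_pXn2r _ 2) ?nnegrE ?mdist_ge0 ?(ltW e0) //.
  by apply: le_lt_trans De; rewrite lerDl sqr_ge0.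
have a_lt : a < c.
  rewrite ltNge; apply/negP => ca.
  have : (c - a_bar) ^+ 2 <= (a - a_bar) ^+ 2.
    by rewrite ler_pXn2r ?nnegrE //; lra.
  have := sqr_ge0 (mdist s b); move: Dc; lra.
have : c < f s by rewrite -lte_fin; apply/U_gt/eU; rewrite ballEmdist.
by move: fsa a_lt; rewrite /epigraph/=; lra.
Qed.

End NPC_Jensen.

(** * Independence of finite samples *)

Section tuple_rectangles.
Context {d : measure_display} {E : measurableType d} (k : nat).

Definition rectangle (F : 'I_k -> set E) : set (k.-tuple E) :=
  \bigcap_i [set u | F i (tnth u i)].

Definition rectangles : set (set (k.-tuple E)) :=
  [set A | exists2 F, forall i, measurable (F i) & A = rectangle F].

Lemma setI_closed_rectangles : setI_closed rectangles.
Proof.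
move=> _ _ [F mF ->] [G mG ->]; exists (fun i => F i `&` G i).
  by move=> i; exact: measurableI.
by rewrite -bigcapI.
Qed.

Lemma measurable_rectangle F : (forall i, measurable (F i)) ->
  measurable (rectangle F).
Proof.
move=> mF; apply: fin_bigcap_measurable => // i _.
by rewrite -[X in measurable X]setTI; exact: measurable_tnth.
Qed.

Lemma measurable_tupleE :
  measurable = <<s rectangles >> :> set (set (k.-tuple E)).
Proof.
apply/seteqP; split; last first.
  apply: smallest_sub; first exact: sigma_algebra_measurable.
  by move=> _ [F mF ->]; exact: measurable_rectangle.
apply: smallest_sub; first exact: smallest_sigma_algebra.
elim/big_ind : _ => //; first by move=> A B sA sB C [/sA|/sB].
move=> i _ _ [B mB <-]; apply: sub_sigma_algebra.
(* The preimage of [B] by one coordinate is a rectangle whose other sides are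
   full. *)
exists (fun j => if j == i then B else setT).
  by move=> j; case: ifP.
apply/seteqP; split => u /=.
  by move=> [_ uB] j _ /=; case: eqP => // ->.
by move=> /(_ i Logic.I)/=; rewrite eqxx.
Qed.

End tuple_rectangles.

Section independence.
Context {R : realType} {dO dE : measure_display}.
Context {Omega : measurableType dO} {E : measurableType dE}.
Variable P : probability Omega R.

Lemma measurable_sample (I : Type) (X : I -> Omega -> E) k (s : 'I_k -> I) :
  (forall i, measurable_fun setT (X i)) ->
  measurable_fun setT (fun w => [tuple X (s i) w | i < k]).
Proof.
move=> mX; apply/measurable_fun_tnthP => i.
rewrite (_ : _ \o _ = X (s i))//.
by apply/funext => w /=; rewrite tnth_mktuple.
Qed.

(** Independence of [T] and [Y], with the law [mu] of [Y] as a parameter: the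
    past is independent of several variables that share their law, and they can
    then be exchanged. *)
Definition independent_of d' (U : measurableType d') (T : Omega -> U)
    (Y : Omega -> E) (mu : set E -> \bar R) :=
  forall A B, measurable A -> measurable B ->
    P (T @^-1` A `&` Y @^-1` B) = (P (T @^-1` A) * mu B)%E.

(** Independence is used twice, for the indices in the range of [s] with and
    without [j]; the two products differ by the factor of [j]. *)
Lemma mutually_independent_rectangle (I : choiceType) (X : I -> Omega -> E)
    k (s : 'I_k -> I) (j : I) (F : 'I_k -> set E) (B : set E) :
  mutually_independent P X -> injective s -> (forall i, s i != j) ->
  (forall i, measurable (F i)) -> measurable B ->
  let T w := [tuple X (s i) w | i < k] in
  P (T @^-1` rectangle F `&` X j @^-1` B) =
  (P (T @^-1` rectangle F) * P (X j @^-1` B))%E.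
Proof.
move=> indep s_inj sNj mF mB T.
pose A l := if [pick i | s i == l] is Some i then F i else B.
have As i : A (s i) = F i.
  rewrite /A; case: pickP => [i' /eqP/s_inj ->//|/(_ i)]; by rewrite eqxx.
have Aj : A j = B.
  by rewrite /A; case: pickP => // i /eqP sij; have := sNj i; rewrite sij eqxx.
have mA l : measurable (A l) by rewrite /A; case: pickP.
pose J : {fset I} := [fset s i | i in 'I_k]%fset.
have TF : T @^-1` rectangle F = \bigcap_(l in [set` J]) X l @^-1` A l.
  apply/seteqP; split => w /=.
    move=> wF l /= /imfsetP[i _ ->]; rewrite As.
    by have := wF i Logic.I; rewrite /= tnth_mktuple.
  move=> wJ i _ /=; rewrite tnth_mktuple -As.
  by apply: wJ => /=; apply/imfsetP; exists i.
have jNJ : j \notin J.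
  by apply/imfsetP => -[i _ /eqP]; rewrite eq_sym; apply/negP.
have -> : T @^-1` rectangle F `&` X j @^-1` B =
    \bigcap_(l in [set` (j |` J)%fset]) X l @^-1` A l.
  rewrite TF; apply/seteqP; split => w /=.
    move=> [wJ wB] l /= /fset1UP[->|lJ]; [by rewrite Aj|exact: wJ].
  move=> wJ; split.
    by move=> l lJ; apply: wJ => /=; rewrite in_fset1U lJ orbT.
  by rewrite -Aj; apply: wJ; rewrite /= fset1U1.
rewrite TF !indep// big_fsetU1//= Aj.
by rewrite muleC.
Qed.

(** For a fixed [B], both sides are finite measures in [A] that agree on
    rectangles, a generating family closed under intersection. *)
Lemma mutually_independent_tuple (I : choiceType) (X : I -> Omega -> E)
    k (s : 'I_k -> I) (j : I) :
  (forall i, measurable_fun setT (X i)) -> mutually_independent P X ->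
  injective s -> (forall i, s i != j) ->
  independent_of (fun w => [tuple X (s i) w | i < k]) (X j)
    (fun B => P (X j @^-1` B)).
Proof.
move=> mX indep s_inj sNj A B mA mB.
set T := fun w => _.
have mT : measurable_fun setT T by exact: measurable_sample.
have mXB : measurable (X j @^-1` B) by rewrite -[_ @^-1` _]setTI; exact: mX.
pose c := NngNum (fine_ge0 (measure_ge0 P (X j @^-1` B))).
pose T' : {mfun Omega >-> k.-tuple E} :=
  HB.pack T (isMeasurableFun.Build _ _ _ _ _ mT).
(* [m1] takes as argument the measurability of [T'], on which the structure of
   measure of a pushforward depends. *)
pose m1 : {measure set _ -> \bar R} := pushforward (mrestr P mXB) T'.
pose m2 : {measure set _ -> \bar R} := mscale c (distribution P T').
have : m1 mT A = m2 A.
  have := @measure_unique _ R _ (@rectangles _ E k) (fun=> setT)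
    _ _ _ _ (m1 mT) m2.
  apply => //.
  - exact: measurable_tupleE.
  - exact: setI_closed_rectangles.
  - move=> _; exists (fun=> setT) => //.
    by apply/seteqP; split.
  - by rewrite bigcup_const.
  - move=> _ [F mF ->].
    rewrite /m2 /= /mscale/= fineK ?fin_num_measure // muleC.
    exact: mutually_independent_rectangle.
  - move=> _; rewrite /m1 /pushforward /mrestr/=.
    by rewrite (le_lt_trans (probability_le1 _ _)) ?ltry// setTI.
by rewrite /m1 /m2 /= /mscale/= fineK ?fin_num_measure // muleC.
Qed.

End independence.

(** * Functions with an integrable positive or negative part *)

Section real_integrable.
Context {R : realType} {d : measure_display} {T : measurableType d}.
Variable mu : {measure set T -> \bar R}.
Implicit Types f g : T -> R.
Local Notation integrableR f := (mu.-integrable setT (EFin \o f)).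

Lemma integrable_between f g h : measurable_fun setT f ->
  integrableR g -> integrableR h -> (forall x, g x <= f x <= h x) ->
  integrableR f.
Proof.
move=> mf ig ih gfh.
apply: (@le_integrable _ _ _ _ _ _ _ (fun x => `|(g x)%:E| + `|(h x)%:E|)%E).
- exact: measurableT.
- exact/measurable_EFinP.
- move=> x _ /=; rewrite !lee_fin; have /andP[gf fh] := gfh x.
  rewrite [leRHS]ger0_norm ?addr_ge0 // ler_norml.
  have := ler_norm (h x); have := normr_ge0 (g x); have := normr_ge0 (h x).
  have : - `|g x| <= g x by rewrite lerNl -normrN ler_norm.
  by move=> ? ? ? ?; apply/andP; split; lra.
- by apply: (@integrableD _ _ _ mu) => //; exact: integrable_abse.
Qed.

Lemma integrable_funrpos_le f g : measurable_fun setT f ->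
  integrableR g^\+ -> (forall x, f x <= g x) -> integrableR f^\+.
Proof.
move=> mf ig fg.
apply: (@integrable_between _ (cst 0) g^\+) => //.
- exact: measurable_funrpos.
- exact: integrable0.
- move=> x; rewrite funrpos_ge0/=.
  by apply: (@funrpos_le _ _ setT) => [y _|]; rewrite ?inE.
Qed.

(** A summand is the sum minus the other summands, hence is bounded below by
    minus the negative part of the sum and the positive parts of the others. *)
Lemma integrable_summand (I : finType) (f : I -> T -> R) :
  (forall i, measurable_fun setT (f i)) -> (forall i, integrableR (f i)^\+) ->
  integrableR (fun x => \sum_i f i x)^\- -> forall i, integrableR (f i).
Proof.
move=> mf fpos sumneg i.
pose S x := \sum_i f i x.
apply: (@integrable_between _
  (fun x => - (S^\- x + \sum_j (f j)^\+ x)) (f i)^\+) => //.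
- pose g j : T -> \bar R := EFin \o (f j)^\+.
  have -> : EFin \o (fun x => - (S^\- x + \sum_j (f j)^\+ x)) =
      (-%E \o ((EFin \o S^\-%R) \+ (fun x => \sum_j g j x)))%E.
    by apply/funext => x /=; rewrite sumEFin.
  apply: integrableN; apply: integrableD => //.
  by apply: (integrable_sum measurableT) => j _; exact: fpos.
- move=> x; have fle j : f j x <= (f j)^\+ x by rewrite /funrpos le_max lexx.
  rewrite fle andbT.
  have sum_ge : - (\sum_j f j x) <= S^\- x.
    by rewrite /funrneg le_max lexx.
  have sum_le : \sum_(j | j != i) f j x <= \sum_j (f j)^\+ x.
    rewrite [leRHS](bigD1 i)//= -[leLHS]add0r lerD ?funrpos_ge0//.
    exact: ler_sum.
  by move: sum_ge sum_le; rewrite (bigD1 i)//=; lra.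
Qed.

Lemma ge0_integrableP f : measurable_fun setT f -> (forall x, 0 <= f x) ->
  integrableR f <-> (\int[mu]_x (f x)%:E < +oo)%E.
Proof.
move=> mf f0.
have abs_f : (\int[mu]_x `|(f x)%:E| = \int[mu]_x (f x)%:E)%E.
  by apply: eq_integral => x _; rewrite gee0_abs// lee_fin.
split=> [/integrableP[_]|foo]; first by rewrite abs_f.
by apply/integrableP; split; [exact/measurable_EFinP|rewrite abs_f].
Qed.

Lemma integrable_funrposneg f :
  integrableR f^\+ -> integrableR f^\- -> integrableR f.
Proof.
move=> fpos fneg.
have -> : EFin \o f = ((EFin \o f^\+%R) \- (EFin \o f^\-%R))%E.
  by apply/funext => x /=; rewrite -{1}(funrposBneg f).
exact: integrableB.
Qed.

Lemma integral_funrposneg f :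
  (\int[mu]_x (f x)%:E =
   \int[mu]_x (f^\+ x)%:E - \int[mu]_x (f^\- x)%:E)%E.
Proof.
by rewrite integralE -/(EFin \o f) funerpos funerneg.
Qed.

Lemma integralN_EFin f : integrableR f ->
  (\int[mu]_x ((\- f) x)%:E = - \int[mu]_x (f x)%:E)%E.
Proof. by move=> fint; rewrite -integralN //; exact: integrable_add_def. Qed.

Lemma integrable_funrposD f g :
  measurable_fun setT f -> measurable_fun setT g ->
  integrableR f^\+ -> integrableR g^\+ -> integrableR (fun x => f x + g x)^\+.
Proof.
move=> mf mg fpos gpos.
apply: (@integrable_between _ (cst 0) (fun x => f^\+ x + g^\+ x)).
- exact/measurable_funrpos/measurable_funD.
- exact: integrable0.
- exact: (integrableD measurableT fpos gpos).
- move=> x; rewrite funrpos_ge0/= /funrpos ge_max.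
  by rewrite addr_ge0 ?le_max ?lexx ?orbT // andbT lerD // le_max lexx.
Qed.

Lemma integrable_funrpos_sum (I : Type) (s : seq I) (f : I -> T -> R) :
  (forall i, measurable_fun setT (f i)) ->
  (forall i, integrableR (f i)^\+) ->
  integrableR (fun x => \sum_(i <- s) f i x)^\+.
Proof.
move=> mf fpos; elim: s => [|i s IHs].
  under [X in (EFin \o X^\+)]eq_fun do rewrite big_nil.
  apply: integrable_funrpos => //; exact: integrable0.
under [X in (EFin \o X^\+)]eq_fun do rewrite big_cons.
by apply: integrable_funrposD => //; exact: measurable_sum.
Qed.

End real_integrable.

(** * Integration against independent variables *)

Section independent_integration.
Context {R : realType} {dO dU dE : measure_display}.
Context {Omega : measurableType dO} {U : measurableType dU}.
Context {E : measurableType dE}.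
Variables (P : probability Omega R) (mu : probability E R).
Variables (T : Omega -> U) (Y : Omega -> E).
Hypotheses (mT : measurable_fun setT T) (mY : measurable_fun setT Y).
Hypothesis indep : independent_of P T Y mu.

Lemma ge0_integral_independent (f : U * E -> \bar R) :
  measurable_fun setT f -> (forall x, 0 <= f x)%E ->
  (\int[P]_w f (T w, Y w) = \int[P]_w \int[mu]_z f (T w, z))%E.
Proof.
move=> mf f0.
pose T' : {mfun Omega >-> U} :=
  HB.pack T (isMeasurableFun.Build _ _ _ _ _ mT).
have mTY : measurable_fun setT (fun w => (T w, Y w)).
  exact: measurable_fun_pair.
pose TY : {mfun Omega >-> (U * E)%type} :=
  HB.pack (fun w => (T w, Y w)) (isMeasurableFun.Build _ _ _ _ _ mTY).
transitivity (\int[distribution P TY]_x f x)%E.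
  by rewrite ge0_integral_distribution.
transitivity (\int[distribution P T' \x mu]_x f x)%E.
  apply: eq_measure_integral => A mA _.
  exact/esym/product_measure_unique.
rewrite fubini_tonelli1 // ge0_integral_distribution //.
- exact: measurable_fun_fubini_tonelli_F.
- by move=> u; exact: integral_ge0.
Qed.

Lemma measurable_partial_integral (f : U * E -> R) : measurable_fun setT f ->
  measurable_fun setT (fun u => fine (\int[mu]_z (f (u, z))%:E)).
Proof.
move=> mf; apply: measurableT_comp => //.
have -> : (fun u => \int[mu]_z (f (u, z))%:E)%E =
    ((fun u => \int[mu]_z (f^\+ (u, z))%:E) \-
     (fun u => \int[mu]_z (f^\- (u, z))%:E))%E.
  by apply/funext => u; rewrite integral_funrposneg.
apply: emeasurable_funB.
- apply: (measurable_fun_fubini_tonelli_F (EFin \o f^\+)) => [|x].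
    exact/measurable_EFinP/measurable_funrpos.
  by rewrite lee_fin funrpos_ge0.
- apply: (measurable_fun_fubini_tonelli_F (EFin \o f^\-)) => [|x].
    exact/measurable_EFinP/measurable_funrneg.
  by rewrite lee_fin funrneg_ge0.
Qed.

Section conditional_mean.
Variables (f : U * E -> R) (g : U -> R).
Hypotheses (mf : measurable_fun setT f) (mg : measurable_fun setT g).

(** When [T] and [Y] are independent and [mu] is the law of [Y], this says that
    [g (T w)] is the conditional expectation of [f (T w, Y w)] given [T], in
    the sense used for generalized martingales: finite for almost every value of
    [T], while [f (T w, Y w)] itself may fail to be integrable. *)
Definition conditional_mean := {ae P, forall w,
  mu.-integrable setT (fun z => (f (T w, z))%:E) /\
  (\int[mu]_z (f (T w, z))%:E = (g (T w))%:E)%E}.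

Hypothesis f_mean : conditional_mean.

Let F w := f (T w, Y w).
Let G w := g (T w).
Let Fpos w := (\int[mu]_z (f^\+ (T w, z))%:E)%E.
Let Fneg w := (\int[mu]_z (f^\- (T w, z))%:E)%E.
Local Notation integrableR h := (P.-integrable setT (EFin \o h)).

Let mF : measurable_fun setT F.
Proof. by apply: measurableT_comp => //; exact: measurable_fun_pair. Qed.

Let mG : measurable_fun setT G.
Proof. exact: measurableT_comp. Qed.

Let mfpos : measurable_fun setT (fun x => (f^\+ x)%:E).
Proof. exact/measurable_EFinP/measurable_funrpos. Qed.

Let mfneg : measurable_fun setT (fun x => (f^\- x)%:E).
Proof. exact/measurable_EFinP/measurable_funrneg. Qed.

Let mFpos : measurable_fun setT Fpos.
Proof.
apply: (@measurableT_comp _ _ _ _ _ _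
  (fun u => \int[mu]_z (f^\+ (u, z))%:E)%E) => //.
apply: (measurable_fun_fubini_tonelli_F (EFin \o f^\+)) => // x.
by rewrite lee_fin funrpos_ge0.
Qed.

Let mFneg : measurable_fun setT Fneg.
Proof.
apply: (@measurableT_comp _ _ _ _ _ _
  (fun u => \int[mu]_z (f^\- (u, z))%:E)%E) => //.
apply: (measurable_fun_fubini_tonelli_F (EFin \o f^\-)) => // x.
by rewrite lee_fin funrneg_ge0.
Qed.

Let Fpos_ge0 w : (0 <= Fpos w)%E.
Proof. by apply: integral_ge0 => z _; rewrite lee_fin funrpos_ge0. Qed.

Let Fneg_ge0 w : (0 <= Fneg w)%E.
Proof. by apply: integral_ge0 => z _; rewrite lee_fin funrneg_ge0. Qed.

Let integral_Fpos : (\int[P]_w (F^\+ w)%:E = \int[P]_w Fpos w)%E.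
Proof.
apply: (@ge0_integral_independent (fun x => (f^\+ x)%:E)) => // x.
by rewrite lee_fin funrpos_ge0.
Qed.

Let integral_Fneg : (\int[P]_w (F^\- w)%:E = \int[P]_w Fneg w)%E.
Proof.
apply: (@ge0_integral_independent (fun x => (f^\- x)%:E)) => // x.
by rewrite lee_fin funrneg_ge0.
Qed.

Let FposBneg : {ae P, forall w,
  [/\ Fpos w \is a fin_num, Fneg w \is a fin_num &
      (Fpos w - Fneg w = (G w)%:E)%E]}.
Proof.
move: f_mean; apply: filterS => w [f_int f_eq].
split.
- by apply: integrable_fin_num => //; exact: (integrable_funrpos _ f_int).
- by apply: integrable_fin_num => //; exact: (integrable_funrneg _ f_int).
- by rewrite -f_eq integral_funrposneg.
Qed.

(** Conditional Jensen inequality for the positive part: [g (T w)] is at most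
    the conditional expectation of the positive part of [f (T w, Y w)]. *)
Lemma conditional_mean_funrpos : integrableR F^\+ -> integrableR G^\+.
Proof.
move=> /ge0_integrableP iF.
apply/ge0_integrableP; [exact: measurable_funrpos| |].
  by move=> w; rewrite funrpos_ge0.
apply: le_lt_trans (iF _ _).
- rewrite integral_Fpos; apply: ae_ge0_le_integral => //.
  + by move=> w _; rewrite lee_fin funrpos_ge0.
  + exact/measurable_EFinP/measurable_funrpos.
  + move: FposBneg; apply: filterS => w [pfin nfin GE] _.
    rewrite /funrpos EFin_max ge_max Fpos_ge0 andbT -GE.
    by rewrite leeBlDr // leeDl.
- exact: measurable_funrpos.
- by move=> w; rewrite funrpos_ge0.
Qed.

(** The tower property when only the positive part of [F] is known to be
    integrable. The integrability of [G] carries over to the negative part of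
    [F], as [Fneg = Fpos - G] almost surely. *)
Lemma conditional_mean_integral : integrableR F^\+ -> integrableR G ->
  integrableR F /\ (\int[P]_w (F w)%:E = \int[P]_w (G w)%:E)%E.
Proof.
move=> iFpos iG.
have iFpos' : P.-integrable setT Fpos.
  apply/integrableP; split => //.
  under eq_integral do rewrite gee0_abs //.
  rewrite -integral_Fpos; apply/ge0_integrableP => //.
  exact: measurable_funrpos.
have Fneg_eq : (\int[P]_w Fneg w = \int[P]_w Fpos w - \int[P]_w (G w)%:E)%E.
  rewrite -integralB //; apply: ae_eq_integral => //.
    by apply: emeasurable_funB => //; exact/measurable_EFinP.
  move: FposBneg; apply: filterS => w [pfin nfin <-] _.
  by rewrite oppeB ?fin_num_adde_defl ?fin_numN // addeA subee // add0e.
have Fpos_fin := integrable_fin_num measurableT iFpos'.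
have G_fin := integrable_fin_num measurableT iG.
have iFneg : integrableR F^\-.
  apply/ge0_integrableP => //; first exact: measurable_funrneg.
  rewrite integral_Fneg Fneg_eq -ge0_fin_numE.
    by rewrite fin_numB Fpos_fin.
  by rewrite -Fneg_eq; apply: integral_ge0.
split; first exact: integrable_funrposneg.
rewrite integral_funrposneg integral_Fpos integral_Fneg Fneg_eq.
by rewrite oppeB ?fin_num_adde_defl ?fin_numN // addeA subee // add0e.
Qed.

End conditional_mean.

End independent_integration.

Section identical_law.
Context {R : realType} {dO dE : measure_display}.
Context {Omega : measurableType dO} {E : measurableType dE}.
Variables (P : probability Omega R) (mu : {measure set E -> \bar R}).
Variables (Y : Omega -> E).
Hypothesis mY : measurable_fun setT Y.
Hypothesis lawY : forall B, measurable B -> P (Y @^-1` B) = mu B.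

Let ge0_integral_law (f : E -> R) : measurable_fun setT f ->
  (forall z, 0 <= f z) ->
  (\int[P]_w (f (Y w))%:E = \int[mu]_z (f z)%:E)%E.
Proof.
move=> mf f0.
pose Y' : {mfun Omega >-> E} :=
  HB.pack Y (isMeasurableFun.Build _ _ _ _ _ mY).
transitivity (\int[distribution P Y']_z (f z)%:E)%E.
  rewrite ge0_integral_distribution //; exact/measurable_EFinP.
by apply: eq_measure_integral => A mA _; exact: lawY.
Qed.

Lemma integral_law (f : E -> R) : measurable_fun setT f ->
  (\int[P]_w (f (Y w))%:E = \int[mu]_z (f z)%:E)%E.
Proof.
move=> mf; rewrite (integral_funrposneg P (f \o Y)) (integral_funrposneg mu f).
have fpos := ge0_integral_law (measurable_funrpos mf) (funrpos_ge0 f).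
have fneg := ge0_integral_law (measurable_funrneg mf) (funrneg_ge0 f).
by rewrite -fpos -fneg.
Qed.

Lemma integrable_funrpos_law (f : E -> R) : measurable_fun setT f ->
  P.-integrable setT (EFin \o (f \o Y)^\+) <->
  mu.-integrable setT (EFin \o f^\+).
Proof.
move=> mf; have mfY : measurable_fun setT (f \o Y) by exact: measurableT_comp.
have mf' := measurable_funrpos mf; have mfY' := measurable_funrpos mfY.
split=> /ge0_integrableP foo; apply/ge0_integrableP => //.
- by rewrite -integral_law // foo // => w; exact: funrpos_ge0.
- by have /= -> := integral_law mf'; rewrite foo // => w; exact: funrpos_ge0.
Qed.

End identical_law.

(** * Initial segments of sequences *)

Section first_terms.
Context {d : measure_display} {E : measurableType d}.

Lemma eq_first_terms (s s' : nat -> E) k :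
  (forall i, (i < k)%N -> s i = s' i) -> first_terms s k = first_terms s' k.
Proof.
by move=> ss'; apply: eq_from_tnth => i; rewrite !tnth_mktuple ss'.
Qed.

Lemma nth_first_terms (s : nat -> E) k i : (i < k)%N ->
  nth point (first_terms s k) i = s i.
Proof.
by move=> ik; rewrite -(tnth_nth _ _ (Ordinal ik)) tnth_mktuple.
Qed.

Lemma first_terms_nth (s : nat -> E) k i : (i <= k)%N ->
  first_terms (nth point (first_terms s k)) i = first_terms s i.
Proof.
move=> ik; apply: eq_first_terms => j ji.
by rewrite nth_first_terms // (leq_trans ji).
Qed.

Lemma measurable_nth k i :
  measurable_fun setT (fun u : k.-tuple E => nth point u i).
Proof.
have [ik|ki] := ltnP i k.
  rewrite (_ : (fun u => _) = (@tnth k E)^~ (Ordinal ik)).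
    exact: measurable_tnth.
  by apply/funext => u; rewrite (tnth_nth point).
rewrite (_ : (fun u => _) = cst point) //.
by apply/funext => u; rewrite nth_default // size_tuple.
Qed.

Lemma measurable_first_terms_nth k i :
  measurable_fun setT (fun u : k.-tuple E => first_terms (nth point u) i).
Proof.
apply/measurable_fun_tnthP => j.
rewrite (_ : _ \o _ = fun u : k.-tuple E => nth point u j).
  exact: measurable_nth.
by apply/funext => u /=; rewrite tnth_mktuple.
Qed.

End first_terms.

(** * From regret to risk *)

Section online_to_batch.
Context {R : realType} {M : Type} {dE dO : measure_display}.
Context {E : measurableType dE} {Omega : measurableType dO}.
Variables (P : probability Omega R) (loss : M -> E -> R).
Variables (m : forall t : nat, t.-tuple E -> M).
Variables (Z : Omega -> E) (Zs : nat -> Omega -> E).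
Hypothesis iid_Z : iid P (oapp Zs Z).
Hypothesis measurable_loss_m : forall t : nat,
  measurable_fun setT (fun u : t.-tuple E * E => loss (m u.1) u.2).

Let mZ : measurable_fun setT Z.
Proof. by have [mX _ _] := iid_Z; exact: (mX None). Qed.

Let mZs k : measurable_fun setT (Zs k).
Proof. by have [mX _ _] := iid_Z; exact: (mX (Some k)). Qed.

Let Z_mfun : {mfun Omega >-> E} :=
  HB.pack Z (isMeasurableFun.Build _ _ _ _ _ mZ).

Let mu : probability E R := distribution P Z_mfun.

Definition past k w : k.-tuple E := first_terms (Zs^~ w) k.

Let mpast k : measurable_fun setT (past k).
Proof.
apply: (@measurable_sample _ _ _ _ _ Zs k (@nat_of_ord k)).
exact: mZs.
Qed.

Let law_Zs k B : measurable B -> P (Zs k @^-1` B) = mu B.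
Proof. by move=> mB; have [_ _ /(_ (Some k) None)->] := iid_Z. Qed.

Let indep_past k j : (forall i, (i < k)%N -> Some i != j) ->
  independent_of P (past k) (oapp Zs Z j) mu.
Proof.
move=> past_j A B mA mB; have [mX indepX idX] := iid_Z.
have s_inj : injective (fun i : 'I_k => Some (i : nat)).
  by move=> i i' [] /val_inj.
have := @mutually_independent_tuple _ _ _ _ _ P _ _ k _ j mX indepX s_inj
  (fun i => past_j i (ltn_ord i)) A B mA mB.
by rewrite (idX j None B mB).
Qed.

Let indep_Z k : independent_of P (past k) Z mu.
Proof. exact: (indep_past (j := None)). Qed.

Let indep_Zs k : independent_of P (past k) (Zs k) mu.
Proof.
apply: (indep_past (j := Some k)) => i ik.
by apply/eqP => -[ik']; rewrite ik' ltnn in ik.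
Qed.

Definition risk k (u : k.-tuple E) : R := fine (\int[mu]_z (loss (m u) z)%:E).

Let mrisk k : measurable_fun setT (@risk k).
Proof.
apply: (measurable_partial_integral mu
  (f := fun x : k.-tuple E * E => loss (m x.1) x.2)).
exact: measurable_loss_m.
Qed.

(** A process indexed by sequences rather than tuples: the first [k] terms of
    [s] determine [compensated s k], which is viewed as a function on tuples by
    extending a tuple [u] to the sequence [nth point u]. *)
Definition compensated (s : nat -> E) k : R :=
  \sum_(i < k) (loss (prediction m s i) (s i) - risk (first_terms s i)).

Let compensated_nth (s : nat -> E) k :
  compensated (nth point (first_terms s k)) k = compensated s k.
Proof.
apply: eq_bigr => i _; have ik := ltnW (ltn_ord i).
by rewrite /prediction first_terms_nth // nth_first_terms.
Qed.

Let mloss_nth k i d' (T : measurableType d')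
    (y : T -> k.-tuple E) (z : T -> E) :
  measurable_fun setT y -> measurable_fun setT z ->
  measurable_fun setT (fun w => loss (prediction m (nth point (y w)) i) (z w)).
Proof.
move=> my mz.
apply: (@measurableT_comp _ _ _ _ _ _
  (fun x : i.-tuple E * E => loss (m x.1) x.2) _
  (fun w => (first_terms (nth point (y w)) i, z w))).
  exact: measurable_loss_m.
apply: measurable_fun_pair => //.
exact: (measurableT_comp (@measurable_first_terms_nth _ _ k i) my).
Qed.

Let mrisk_nth k i :
  measurable_fun setT
    (fun u : k.-tuple E => risk (first_terms (nth point u) i)).
Proof.
exact: (measurableT_comp (@mrisk i) (@measurable_first_terms_nth _ _ k i)).
Qed.

Let mcompensated k :
  measurable_fun setT (fun u : k.-tuple E => compensated (nth point u) k).
Proof.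
apply: measurable_sum => i; apply: measurable_funB; last exact: mrisk_nth.
by apply: mloss_nth; [exact: measurable_id|exact: measurable_nth].
Qed.

Definition integrable_loss n := {ae P, forall w, forall i, (i <= n)%N ->
  mu.-integrable setT (EFin \o loss (prediction m (Zs^~ w) i))}.

Local Notation integrableR h := (P.-integrable setT (EFin \o h)).

(** Positive parts are transmitted backwards, by the conditional Jensen
    inequality, from time [k.+1] to time [k], so that they are all integrable;
    the tower property then transmits integrability and the zero mean forwards.
    This is the theorem that a generalized martingale with an integrable final
    positive part is a martingale. *)
Lemma compensated_martingale n k : integrable_loss n -> (k <= n.+1)%N ->
  let D w := compensated (Zs^~ w) k in
  integrableR D^\+ -> integrableR D /\ (\int[P]_w (D w)%:E = 0)%E.
Proof.
move=> int_loss; elim: k => [|k IHk] kn D.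
  move=> _; have -> : D = cst 0.
    by apply/funext => w; rewrite /D /compensated big_ord0.
  by split; [exact: integrable0|rewrite integral0].
pose g (u : k.-tuple E) := compensated (nth point u) k.
pose f (x : k.-tuple E * E) := g x.1 + (loss (m x.1) x.2 - risk x.1).
have mf : measurable_fun setT f.
  apply: measurable_funD.
    exact: (measurableT_comp (@mcompensated k) measurable_fst).
  apply: measurable_funB; first exact: measurable_loss_m.
  exact: (measurableT_comp (@mrisk k) measurable_fst).
have gE w : g (past k w) = compensated (Zs^~ w) k by exact: compensated_nth.
have DE w : D w = f (past k w, Zs k w).
  by rewrite /f/= gE /D /compensated big_ord_recr.
have f_mean : conditional_mean P mu (past k) f g.
  move: int_loss; apply: filterS => w /(_ k kn) int_k.
  rewrite /f/=; set c := g _; set r := risk _.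
  have fE z : (c + (loss (m (past k w)) z - r))%:E =
      ((c - r)%:E + (loss (m (past k w)) z)%:E)%E.
    by rewrite -EFinD; congr EFin; ring.
  have int_c : mu.-integrable setT (cst (c - r)%:E).
    exact: finite_measure_integrable_cst.
  split.
    under [X in _.-integrable _ X]eq_fun do rewrite fE.
    exact: integrableD.
  under eq_integral do rewrite fE.
  rewrite integralD // integral_cst //.
  rewrite [X in (_ * X + _)%E](probability_setT mu) mule1.
  rewrite -[X in (_ + X)%E]fineK; last exact: integrable_fin_num.
  by rewrite -EFinD /r /risk subrK.
have -> : D = fun w => f (past k w, Zs k w) by apply/funext.
move=> fpos.
have gpos := conditional_mean_funrpos (@mpast k) (@mZs k) (@indep_Zs k)
  mf (@mcompensated k) f_mean fpos.
have {}IHk := IHk (ltnW kn).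
have gE' : (fun w => g (past k w)) = (fun w => compensated (Zs^~ w) k).
  exact/funext.
rewrite gE' in gpos; have [gint g0] := IHk gpos.
have [||Dint ->] := conditional_mean_integral (@mpast k) (@mZs k) (@indep_Zs k)
  mf (@mcompensated k) f_mean => //; first by rewrite gE'.
by split=> //; rewrite -g0; apply: eq_integral => w _; congr EFin; exact: gE.
Qed.

Variables (comparator : E -> R) (B : nat -> R).
Hypothesis measurable_comparator : measurable_fun setT comparator.
Hypothesis comparator_pos :
  integrableR (fun w => comparator (Z w))^\+.
Hypothesis regret_comparator : forall T, (1 <= T)%N -> forall s : nat -> E,
  \sum_(t < T) loss (prediction m s t) (s t) <=
  B T + \sum_(t < T) comparator (s t).

Let mloss_pred k (u : k.-tuple E) : measurable_fun setT (loss (m u)).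
Proof.
by have := measurable_fun_pair2 u (@measurable_loss_m k).
Qed.

Let comparator_pos_mu :
  mu.-integrable setT (EFin \o comparator^\+).
Proof. by apply/(integrable_funrpos_law mZ (mu := mu)). Qed.

Let comparator_pos_Zs k : integrableR (fun w => comparator (Zs k w))^\+.
Proof. by apply/(integrable_funrpos_law (@mZs k) (mu := mu) (@law_Zs k)). Qed.

Let integral_comparator_Zs k :
  (\int[P]_w (comparator (Zs k w))%:E = \int[P]_w (comparator (Z w))%:E)%E.
Proof.
by rewrite (integral_law (@mZs k) (mu := mu) (@law_Zs k)) //
  (integral_law mZ (mu := mu)).
Qed.

(* The regret bound at time [k.+1], for the sequence made of the first [k]
   observations and then of [z], is an upper bound for the loss of the
   prediction on [z] that depends on [z] only through the comparator. *)
Let loss_pred_pos w k :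
  mu.-integrable setT (EFin \o (loss (prediction m (Zs^~ w) k))^\+).
Proof.
pose s z i := if (i < k)%N then Zs i w else z.
have first_s z i : (i <= k)%N -> first_terms (s z) i = first_terms (Zs^~ w) i.
  by move=> ik; apply: eq_first_terms => j ji; rewrite /s (leq_trans ji).
pose c := B k.+1 + \sum_(i < k) comparator (Zs i w)
  - \sum_(i < k) loss (prediction m (Zs^~ w) i) (Zs i w).
apply: (@integrable_funrpos_le _ _ _ _ _ (fun z => c + comparator z)).
- exact: mloss_pred.
- apply: (@integrable_funrposD _ _ _ _ (cst c)) => //.
  by apply: integrable_funrpos => //; exact: finite_measure_integrable_cst.
- move=> z; have := regret_comparator (ltn0Sn k) (s z).
  rewrite !big_ord_recr/= /prediction first_s // /s ltnn.
  under eq_bigr => i _ do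
    rewrite -/(s z) first_s ?(ltnW (ltn_ord i)) // ltn_ord.
  under [X in _ <= B _ + (X + _)]eq_bigr => i _ do rewrite ltn_ord.
  rewrite /c /prediction; lra.
Qed.

Definition batch_loss n w :=
  \sum_(i < n.+1) loss (prediction m (Zs^~ w) i) (Z w).

(* [batch_loss n] as a function of the past and of the new observation, and its
   conditional mean given the past. *)
Let batch_f n (x : n.-tuple E * E) :=
  \sum_(i < n.+1) loss (prediction m (nth point x.1) i) x.2.

Let batch_g n (u : n.-tuple E) :=
  \sum_(i < n.+1) risk (first_terms (nth point u) i).

Let mbatch_f n : measurable_fun setT (@batch_f n).
Proof.
by apply: measurable_sum => i; apply: mloss_nth.
Qed.

Let mbatch_g n : measurable_fun setT (@batch_g n).
Proof. by apply: measurable_sum => i; exact: mrisk_nth. Qed.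

Let batch_fE n w z : batch_f (past n w, z) =
  \sum_(i < n.+1) loss (prediction m (Zs^~ w) i) z.
Proof.
apply: eq_bigr => i _; have := ltn_ord i; rewrite ltnS => i_n.
by rewrite /prediction first_terms_nth.
Qed.

Let batch_gE n w : batch_g (past n w) =
  \sum_(i < n.+1) risk (first_terms (Zs^~ w) i).
Proof.
apply: eq_bigr => i _; have := ltn_ord i; rewrite ltnS => i_n.
by rewrite first_terms_nth.
Qed.

(** Given almost every past, the sum over [i] of the losses on [Z] has an
    integrable negative part, by Tonelli's theorem, and its terms have
    integrable positive parts. *)
Lemma batch_integrable_loss n :
  integrableR (batch_loss n)^\- -> integrable_loss n.
Proof.
have mneg : measurable_fun setT (@batch_f n)^\-.
  by apply: measurable_funrneg; exact: mbatch_f.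
have mF : measurable_fun setT (fun w => batch_f (past n w, Z w)).
  apply: measurableT_comp; first exact: mbatch_f.
  by apply: measurable_fun_pair; [exact: mpast|exact: mZ].
have -> : batch_loss n = fun w => batch_f (past n w, Z w).
  by apply/funext => w; rewrite batch_fE.
move=> /ge0_integrableP => /(_ (measurable_funrneg mF) (funrneg_ge0 _)).
rewrite (ge0_integral_independent (@mpast n) mZ (@indep_Z n)
  (f := fun x => ((@batch_f n)^\- x)%:E)); last 2 first.
- exact/measurable_EFinP.
- by move=> x; rewrite lee_fin funrneg_ge0.
pose Fneg w := (\int[mu]_z ((@batch_f n)^\- (past n w, z))%:E)%E.
move=> Fneg_lt.
have mFneg : measurable_fun setT Fneg.
  apply: (@measurableT_comp _ _ _ _ _ _
    (fun u => \int[mu]_z ((@batch_f n)^\- (u, z))%:E)%E); last exact: mpast.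
  apply: (measurable_fun_fubini_tonelli_F (EFin \o (@batch_f n)^\-)) => [|x].
    exact/measurable_EFinP.
  by rewrite lee_fin funrneg_ge0.
have Fneg_ge0 w : (0 <= Fneg w)%E.
  by apply: integral_ge0 => z _; rewrite lee_fin funrneg_ge0.
have /(integrable_ae measurableT) : P.-integrable setT Fneg.
  apply/integrableP; split => //.
  by under eq_integral do rewrite gee0_abs //; exact: Fneg_lt.
apply: filterS => w /(_ Logic.I) Fneg_fin i i_n.
have i_n' : (i < n.+1)%N by [].
apply: (@integrable_summand _ _ _ mu 'I_n.+1
  (fun i => loss (prediction m (Zs^~ w) i)) _ _ _ (Ordinal i_n')) => [j|j|].
- exact: mloss_pred.
- exact: loss_pred_pos.
have -> : (fun z => \sum_(j < n.+1) loss (prediction m (Zs^~ w) j) z) =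
    (fun z => batch_f (past n w, z)).
  by apply/funext => z; rewrite batch_fE.
apply/ge0_integrableP.
- apply: measurable_funrneg.
  exact: (measurable_fun_pair2 (past n w) (@mbatch_f n)).
- by move=> z; exact: funrneg_ge0.
- by rewrite -ge0_fin_numE; [exact: Fneg_fin|exact: Fneg_ge0].
Qed.

(** With [rho] the sum of the risks and [D] the martingale of the losses
    compensated by the risks, [D + rho] is the cumulative loss of the online
    strategy, bounded above by [V]. The positive part of [D <= V - rho] is
    integrable, so [D] has mean zero; then [rho <= V - D] has an integrable
    positive part as well. Finally [V >= D + rho] is integrable, and so is each
    comparator term in [V]. *)
Lemma batch_loss_le n : integrableR (batch_loss n)^\- ->
  integrableR (batch_loss n) /\
  (\int[P]_w (batch_loss n w)%:E <=
   (B n.+1)%:E + n.+1%:R%:E * \int[P]_w (comparator (Z w))%:E)%E.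
Proof.
move=> batch_neg; have int_loss := batch_integrable_loss batch_neg.
pose rho w := \sum_(i < n.+1) risk (past i w).
pose D w := compensated (Zs^~ w) n.+1.
pose sum_comparator w := \sum_(t < n.+1) comparator (Zs t w).
pose V w := B n.+1 + sum_comparator w.
have mrho : measurable_fun setT rho.
  apply: measurable_sum => i.
  exact: (measurableT_comp (@mrisk i) (@mpast i)).
have mcomp (t : nat) : measurable_fun setT (fun w => comparator (Zs t w)).
  exact: (measurableT_comp measurable_comparator (@mZs t)).
have mV : measurable_fun setT V.
  by apply: measurable_funD => //; apply: measurable_sum => t; exact: mcomp.
have mD : measurable_fun setT D.
  have -> : D = fun w => compensated (nth point (past n.+1 w)) n.+1.
    by apply/funext => w; rewrite compensated_nth.
  exact: (measurableT_comp (@mcompensated n.+1) (@mpast n.+1)).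
have DV w : D w + rho w <= V w.
  have -> : D w + rho w =
      \sum_(i < n.+1) loss (prediction m (Zs^~ w) i) (Zs i w).
    by rewrite -big_split/=; apply: eq_bigr => i _; rewrite subrK.
  exact: (regret_comparator (ltn0Sn n)).
have batchE : batch_loss n = fun w => batch_f (past n w, Z w).
  by apply/funext => w; rewrite batch_fE.
have rhoE : rho = fun w => batch_g (past n w).
  by apply/funext => w; rewrite batch_gE.
(* What is known to be integrable is a negative part, whence the opposites. *)
have f_mean : conditional_mean P mu (past n)
    (\- (@batch_f n)) (\- (@batch_g n)).
  move: int_loss; apply: filterS => w int_w.
  have int_i (i : 'I_n.+1) :
      mu.-integrable setT (EFin \o loss (prediction m (Zs^~ w) i)).
    by apply: int_w; rewrite -ltnS.
  have fE : (fun z => ((\- (@batch_f n)) (past n w, z))%:E) =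
      (-%E \o (fun z => \sum_(i < n.+1)
        (EFin \o loss (prediction m (Zs^~ w) i)) z))%E.
    by apply/funext => z; rewrite /= batch_fE sumEFin.
  have int_sum : mu.-integrable setT (fun z => \sum_(i < n.+1)
      (EFin \o loss (prediction m (Zs^~ w) i)) z)%E.
    by apply: (integrable_sum measurableT) => i _; exact: int_i.
  rewrite fE; split; first exact: integrableN.
  rewrite integralN; last exact: integrable_add_def.
  rewrite integral_sum // /= batch_gE EFinN -sumEFin; congr (- _)%E.
  apply: eq_bigr => i _; rewrite /risk fineK //.
  exact: (integrable_fin_num measurableT (int_i i)).
have mfN : measurable_fun setT (\- (@batch_f n)).
  by apply: measurable_funN; exact: mbatch_f.
have mgN : measurable_fun setT (\- (@batch_g n)).
  by apply: measurable_funN; exact: mbatch_g.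
have fN_pos : integrableR (fun w => (\- (@batch_f n)) (past n w, Z w))^\+.
  have -> : (fun w => (\- (@batch_f n)) (past n w, Z w))^\+ = (batch_loss n)^\-.
    by rewrite batchE -funrposN.
  by [].
have gN_pos := conditional_mean_funrpos (@mpast n) mZ (@indep_Z n)
  mfN mgN f_mean fN_pos.
have rho_neg : integrableR (\- rho)^\+ by rewrite rhoE.
have V_pos : integrableR V^\+.
  apply: (@integrable_funrposD _ _ _ _ (cst (B n.+1))) => //.
  - by apply: measurable_sum => t; exact: mcomp.
  - by apply: integrable_funrpos => //; exact: finite_measure_integrable_cst.
  - apply: integrable_funrpos_sum => t; first exact: mcomp.
    exact: comparator_pos_Zs.
have D_pos : integrableR D^\+.
  apply: (@integrable_funrpos_le _ _ _ _ _ (fun w => V w + - rho w)) => //.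
    apply: integrable_funrposD => //; exact: measurable_funN.
  by move=> w; rewrite lerBrDr.
have [D_int D0] := compensated_martingale int_loss (leqnn n.+1) D_pos.
have rho_int : integrableR rho.
  apply: integrable_funrposneg; last by rewrite -funrposN.
  apply: (@integrable_funrpos_le _ _ _ _ _ (fun w => V w + - D w)) => //.
    apply: integrable_funrposD => //; first exact: measurable_funN.
    by apply: integrable_funrpos => //; exact: (integrableN D_int).
  by move=> w; rewrite lerBrDl.
have rhoN_int : integrableR (fun w => (\- (@batch_g n)) (past n w)).
  have -> : (fun w => (\- (@batch_g n)) (past n w)) = (\- rho) by rewrite rhoE.
  exact: (integrableN rho_int).
have [batchN_int batchN_eq] := conditional_mean_integral (@mpast n) mZ
  (@indep_Z n) mfN mgN f_mean fN_pos rhoN_int.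
have batchNE : (fun w => (\- (@batch_f n)) (past n w, Z w)) = \- batch_loss n.
  by rewrite batchE.
have batch_int : integrableR (batch_loss n).
  rewrite batchNE in batchN_int.
  rewrite (_ : EFin \o _ = -%E \o (EFin \o \- batch_loss n)).
    exact: integrableN.
  by apply/funext => w /=; rewrite opprK.
split=> //.
have -> : (\int[P]_w (batch_loss n w)%:E = \int[P]_w (rho w)%:E)%E.
  apply: oppe_inj.
  rewrite -(integralN_EFin batch_int) -(integralN_EFin rho_int).
  by rewrite batchE rhoE; exact: batchN_eq.
have Drho_int : integrableR (fun w => D w + rho w).
  exact: (integrableD measurableT D_int rho_int).
have V_int : integrableR V.
  apply: integrable_funrposneg => //; rewrite -funrposN.
  apply: (@integrable_funrpos_le _ _ _ _ _ (fun w => - (D w + rho w))).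
  - exact: measurable_funN.
  - by apply: integrable_funrpos => //; exact: (integrableN Drho_int).
  - by move=> w; rewrite lerN2.
have cst_int : P.-integrable setT (cst (B n.+1)%:E).
  exact: finite_measure_integrable_cst.
have sum_int : integrableR sum_comparator.
  rewrite (_ : EFin \o _ = ((EFin \o V) \- cst (B n.+1)%:E)%E).
    exact: integrableB.
  by apply/funext => w /=; rewrite -EFinB /V addrC addKr.
have comparator_int (t : 'I_n.+1) : integrableR (fun w => comparator (Zs t w)).
  apply: (@integrable_summand _ _ _ P 'I_n.+1
    (fun t w => comparator (Zs t w))) => [i|i|]; first exact: mcomp.
    exact: comparator_pos_Zs.
  exact: integrable_funrneg.
have <- : (\int[P]_w (V w)%:E =
    (B n.+1)%:E + n.+1%:R%:E * \int[P]_w (comparator (Z w))%:E)%E.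
  have VE w : (V w)%:E = (cst (B n.+1)%:E w +
      \sum_(t < n.+1) (EFin \o (fun w => comparator (Zs t w))) w)%E.
    by rewrite /= sumEFin -EFinD.
  under eq_integral do rewrite VE.
  rewrite integralD //; last first.
    by apply: (integrable_sum measurableT) => t _; exact: comparator_int.
  rewrite integral_cst // [X in (_ * X + _)%E](probability_setT P) mule1.
  congr (_ + _)%E; rewrite integral_sum //.
  under eq_bigr do rewrite integral_comparator_Zs.
  by rewrite mule_natl sumr_const card_ord.
have -> : (\int[P]_w (rho w)%:E = \int[P]_w (D w + rho w)%:E)%E.
  under [RHS]eq_integral do rewrite EFinD.
  by rewrite integralD // D0 add0e.
by apply: le_integral => // w _; rewrite lee_fin.
Qed.

(** [W] stands for the loss of the barycenter. If its negative part has an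
    infinite integral then its expectation is [-oo], even when the positive part
    has an infinite integral too, since [+oo - +oo = -oo]; otherwise the bound
    by the average carries integrability over to the sum of the losses. *)
Lemma online_to_batch n (W : Omega -> R) : measurable_fun setT W ->
  (forall w, n.+1%:R * W w <=
    \sum_(i < n.+1) loss (prediction m (Zs^~ w) i) (Z w)) ->
  ('E_P[W] <= (B n.+1 / n.+1%:R)%:E + 'E_P[fun w => comparator (Z w)])%E.
Proof.
move=> mW W_le; rewrite expectation.unlock.
have n0 : (0 : R) < n.+1%:R by rewrite ltr0n.
have [Wneg|] := boolP (P.-integrable setT (EFin \o W^\-)); last first.
  move=> /negP Wneg; rewrite integral_funrposneg.
  suff -> : (\int[P]_w (W^\- w)%:E = +oo)%E by rewrite addeNy leNye.
  apply/eqP; rewrite -leye_eq leNgt; apply/negP => lt_oo; apply: Wneg.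
  apply/ge0_integrableP => //; first exact: measurable_funrneg.
have mbatch : measurable_fun setT (batch_loss n).
  rewrite (_ : batch_loss n = fun w => batch_f (past n w, Z w)).
    apply: measurableT_comp; first exact: mbatch_f.
    by apply: measurable_fun_pair; [exact: mpast|exact: mZ].
  by apply/funext => w; rewrite batch_fE.
have [|batch_int batch_le] := @batch_loss_le n.
  rewrite -funrposN.
  apply: (@integrable_funrpos_le _ _ _ _ _ (\- (fun w => n.+1%:R * W w))).
  - exact: measurable_funN.
  - rewrite funrposN ge0_funrnegM ?ler0n //.
    exact: (integrableZl measurableT n.+1%:R Wneg).
  - by move=> w; rewrite lerN2; exact: W_le.
have Wpos : integrableR W^\+.
  apply: (@integrable_funrpos_le _ _ _ _ _
    (fun w => n.+1%:R^-1 * batch_loss n w)).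
  - by [].
  - apply: integrable_funrpos => //.
    exact: (integrableZl measurableT n.+1%:R^-1 batch_int).
  - by move=> w; rewrite -ler_pdivrMl ?invr_gt0 // invrK; exact: W_le.
have W_int := integrable_funrposneg Wpos Wneg.
rewrite -(@lee_pmul2l _ n.+1%:R%:E) ?lte_fin //.
rewrite [leRHS]muleDr ?fin_num_adde_defr //.
rewrite -EFinM mulrCA divff ?gt_eqF // mulr1.
apply: le_trans batch_le; rewrite -(integralZl measurableT W_int).
apply: le_integral => //.
  exact: (integrableZl measurableT n.+1%:R W_int).
by move=> w _; rewrite -EFinM lee_fin; exact: W_le.
Qed.

End online_to_batch.

Lemma regret_le_comparator (R : realType) (M E : Type) (loss : M -> E -> R)
    (m : forall t : nat, t.-tuple E -> M) (Theta : set M) (T : nat)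
    (s : nat -> E) (b : R) (theta : M) :
  (regret loss m Theta T s <= b%:E)%E -> Theta theta ->
  \sum_(t < T) loss (prediction m s t) (s t) <=
  b + \sum_(t < T) loss theta (s t).
Proof.
rewrite /regret; set inf := ereal_inf _ => le_b Theta_theta.
have : (inf <= (\sum_(t < T) loss theta (s t))%:E)%E.
  by apply: ereal_inf_lbound; exists theta.
case: inf le_b => [r| |]; first by rewrite -EFinB !lee_fin; lra.
- by rewrite leye_eq.
- by rewrite addey // leye_eq.
Qed.

(** If the positive part were not integrable, then the negative part would be,
    and the difference of the two integrals would be [+oo]. *)
Lemma expectation_pos_integrable (R : realType) (d : measure_display)
    (T : measurableType d) (P : probability T R) (X : T -> R) :
  measurable_fun setT X -> expectation_exists P X -> ('E_P[X] < +oo)%E ->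
  P.-integrable setT (EFin \o X^\+).
Proof.
rewrite /expectation_exists expectation.unlock => mX X_ex EX.
apply/ge0_integrableP; [exact: measurable_funrpos|exact: funrpos_ge0|].
case: X_ex => // Xneg; rewrite (integral_funrposneg P X) in EX.
have : (0 <= \int[P]_w (X^\- w)%:E)%E.
  by apply: integral_ge0 => w _; rewrite lee_fin; exact: funrneg_ge0.
move: EX Xneg.
case: (\int[P]_w (X^\+ w)%:E)%E => [r| |] //; first by rewrite ltry.
by case: (\int[P]_w (X^\- w)%:E)%E => [r| |].
Qed.

Theorem theorem3p4 (R : realType) (M : metricType R)
  (dE : measure_display) (E : measurableType dE)
  (dOm : measure_display) (Omega : measurableType dOm)
  (P : probability Omega R)
  (loss : M -> E -> R) (Theta : set M)
  (m : forall t : nat, t.-tuple E -> M) (B : nat -> R)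
  (Z : Omega -> E) (Zs : nat -> Omega -> E)
  (theta_ : nat -> Omega -> M)
  (complete_M : complete_metric M) (NPC_M : NPC_space M)
  (loss_convex : forall z : E, geodesically_convex (loss ^~ z))
  (loss_lsc : forall z : E, lower_semicontinuous (fun x : M => (loss x z)%:E))
  (B_gt0 : forall T : nat, (1 <= T)%N -> 0 < B T)
  (regret_le : forall T : nat, (1 <= T)%N -> forall z : nat -> E,
     (regret loss m Theta T z <= (B T)%:E)%E)
  (iid_Z : iid P (oapp Zs Z))
  (theta_argmin : forall n : nat, (1 <= n)%N -> forall omega : Omega,
     argmin (fun x : M =>
       \sum_(i < n.+1) mdist x (prediction m (Zs ^~ omega) i) ^+ 2)
     (theta_ n omega))
  (measurable_loss_m : forall t : nat,
     measurable_fun setT (fun u : t.-tuple E * E => loss (m t u.1) u.2))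
  (measurable_loss_Theta : forall theta : M, Theta theta ->
     measurable_fun setT (loss theta))
  (measurable_loss_theta_ : forall n : nat, (1 <= n)%N ->
     measurable_fun setT (fun omega => loss (theta_ n omega) (Z omega)))
  (expectation_loss_Theta : forall theta : M, Theta theta ->
     expectation_exists P (fun omega => loss theta (Z omega))) :
  forall n : nat, (1 <= n)%N ->
    ('E_P[fun omega => loss (theta_ n omega) (Z omega)]
     - ereal_inf [set 'E_P[fun omega => loss theta (Z omega)]
                 | theta in Theta]
     <= (B n.+1 / n.+1%:R)%:E)%E.
Proof.
move=> n n1; set EW := ('E_P[_])%E; set inf := ereal_inf _; set c := B n.+1 / _.
have EW_le : (EW - c%:E <= inf)%E.
  apply: le_ereal_inf_tmp => _ [theta Theta_theta <-].
  set EL := ('E_P[_])%E.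
  have [->|EL_lt] := eqVneq EL +oo%E; first by rewrite leey.
  have [mX _ _] := iid_Z.
  have mL : measurable_fun setT (fun w => loss theta (Z w)).
    have mtheta := measurable_loss_Theta theta Theta_theta.
    exact: (measurableT_comp mtheta (mX None)).
  rewrite leeBlDr // addeC.
  apply: (online_to_batch iid_Z measurable_loss_m
    (comparator := loss theta)).
  - exact: measurable_loss_Theta.
  - apply: expectation_pos_integrable => //; last by rewrite ltey.
    exact: expectation_loss_Theta.
  - move=> T T1 s.
    exact: regret_le_comparator (regret_le T T1 s) Theta_theta.
  - exact: measurable_loss_theta_.
  - move=> w.
    have := NPC_Jensen NPC_M (theta_argmin n n1 w) (loss_convex (Z w)).
    by rewrite card_ord => -> //; exact: loss_lsc.
(* The infimum may be infinite: [+oo] if there is no competitor of finite mean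
   loss, and [-oo] forces [EW = -oo]. *)
move: EW_le; rewrite leeBlDr //.
by case: inf => [r| |]; case: EW => [e| |] //=;
  rewrite -?EFinB -?EFinD ?lee_fin ?leey ?leNye //; lra.
Qed.
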